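(* There is a function $h(n)=\Theta(n)$ (positive) such that for every even natural number $n$ and every set $V$ of $n$ points in convex position in the plane, $\alpha(D_V(n))\ge \frac{n^2}{6}+h(n)$.
   Context: A set of $n$ points in the plane is in convex position if no three are collinear and they are the vertices of a convex polygon (all internal angles strictly less than $180^\circ$). For such a set $V$, the segment disjointness graph $D_V(n)$ has as vertices all closed straight-line segments with both endpoints in $V$, two segments being adjacent iff they are disjoint (no common point, including endpoints). An $l$-coloring of a graph $G$ is a surjective map $V(G)\to[l]$; it is proper if adjacent vertices get different colors and complete if for every two distinct colors $i,j$ there is an edge with endpoints colored $i$ and $j$. The achromatic number $\alpha(G)$ is the largest $l$ admitting a proper complete $l$-coloring. The paper writes the bound as $\frac{n^2}{6}+\Theta(n)\le \alpha(D_V(n))$. *)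

(* Defs.v *)
From mathcomp Require Import all_boot all_order all_algebra finmap.
From mathcomp Require Import all_classical all_reals all_analysis.

Set Implicit Arguments.
Unset Strict Implicit.
Unset Printing Implicit Defensive.

Import Order.TTheory GRing.Theory Num.Theory.
Import numFieldNormedType.Exports.

Local Open Scope classical_set_scope.
Local Open Scope convex_scope.
Local Open Scope ring_scope.

(* A finite graph is given by its adjacency relation [e] on the finite type
   [T] of its vertices; [l]-colorings are maps to ['I_l]. *)
Section Colorings.
Variables (T : finType) (e : rel T) (l : nat).
Implicit Type c : {ffun T -> 'I_l}.

Definition surjective_coloring c := [forall i : 'I_l, exists x, c x == i].

Definition proper_coloring c :=
  [forall x, forall y, e x y ==> (c x != c y)].

Definition complete_coloring c :=
  [forall i : 'I_l, forall j : 'I_l, (i != j) ==>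
    [exists x, exists y, [&& e x y, c x == i & c y == j]]].

Definition has_complete_coloring :=
  [exists c, [&& surjective_coloring c, proper_coloring c
               & complete_coloring c]].
End Colorings.

(* By surjectivity, a coloring uses at most [#|T|] colors, so the maximum over
   [l <= #|T|] is the maximum over all [l]. *)
Definition achromatic_number (T : finType) (e : rel T) : nat :=
  \max_(l < #|T|.+1 | has_complete_coloring e l) l.

Section Plane.
Variable R : realType.

Local Notation plane := 'rV[R]_2.

Definition collinear (a b c : plane) : Prop :=
  exists p d : plane, forall x, x \in [:: a; b; c] -> exists t : R, x = p + t *: d.

Definition convex_hull (A : set plane) : set plane :=
  smallest (@convex_set R plane) A.

(* Polygons are filled, and may degenerate to a segment, a point or the empty
   set, so that sets of at most two points are in convex position. *)
Definition convex_polygon (P : set plane) : Prop :=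
  exists2 S : set plane, finite_set S & P = convex_hull S.

(* The extreme points of a polygon are its corners with an internal angle
   strictly less than 180 degrees. *)
Definition polygon_vertices (P : set plane) : set plane :=
  [set p | P p /\ forall (x y : convex_lmodType plane) (t : {i01 R}),
    P x -> P y -> 0 < t%:num -> t%:num < 1 -> x <| t |> y = p -> x = y].

Definition convex_position (V : {fset plane}) : Prop :=
  (forall a b c : plane, a \in V -> b \in V -> c \in V ->
     uniq [:: a; b; c] -> ~ collinear a b c) /\
  (exists2 P, convex_polygon P & polygon_vertices P = [set` V]).

Definition closed_segment (a b : plane) : set plane :=
  range (fun t : {i01 R} => (a : convex_lmodType plane) <| t |> b).

(* A segment with endpoints in [V] is represented by its pair of endpoints. *)
Definition segments (V : {fset plane}) : Type :=
  {s : {set V} | #|s| == 2%N}.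

Definition segment_points (V : {fset plane}) (s : segments V) : set plane :=
  [set x | exists a b : V,
     \val s = [set a; b]%SET /\ closed_segment (\val a) (\val b) x].

Definition disjointness_graph (V : {fset plane}) : rel (segments V) :=
  fun s1 s2 => [disjoint segment_points s1 & segment_points s2].

End Plane.

(* Main.v *)
(* Merging colors shows that any family of pairwise intersecting classes of
   segments, no two of which have an intersecting union, has at most as many
   members as the achromatic number.  Take as classes edge-disjoint triangles,
   together with pairwise disjoint sides of the hull polygon as singletons: a
   triangle has two vertices off any other triangle or side, and of three points
   off a line two lie on the same side of it.

   For the triangles, put n = m + 1 with m odd and label the points by Z_m and
   an extra point oo.  The zero-sum 3-subsets of Z_m cover all pairs of Z_m
   except the pairs {x, -2x}, which form the cycles of x |-> -2x.  Color these
   pairs alternately along the cycles; the pairs of one color are completed to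
   triangles by oo, those of the other color become sides of the polygon.  One
   pair is lost per odd cycle, so at most m/7 + 45 in total, since a cycle of
   length 1, 3 or 5 consists of solutions of 3x = 0, 9x = 0 or 33x = 0.  The
   number of classes is then at least n^2/6 + n/42 - 1898/42. *)

Require Import Defs.
From mathcomp Require Import all_boot all_order all_algebra finmap.
From mathcomp Require Import all_classical all_reals all_analysis.
From mathcomp Require Import ring lra zify.

Set Implicit Arguments.
Unset Strict Implicit.
Unset Printing Implicit Defensive.

Import Order.TTheory GRing.Theory Num.Theory.
Import numFieldNormedType.Exports.

Local Open Scope classical_set_scope.
Local Open Scope ring_scope.

(** * Complete colorings *)

(* Take a proper coloring that is constant on each family and uses as few
   colors as possible: two colors with no edge between them could be merged. *)
Lemma achromatic_number_ge (T I : finType) (e : rel T) (F : I -> pred T) :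
  symmetric e ->
  (forall i, exists x, F i x) ->
  (forall i j x, F i x -> F j x -> i = j) ->
  (forall x, ~~ e x x) ->
  (forall i x y, F i x -> F i y -> ~~ e x y) ->
  (forall i j, i != j -> exists x y, [/\ F i x, F j y & e x y]) ->
  (#|I| <= achromatic_number e)%N.
Proof.
move=> esym Fne Finj eirr Find Fcross.
(* Colors are vertices of the graph, so a minimum over a finite type of colorings exists. *)
pose good (f : {ffun T -> T}) :=
  [forall x, forall y, e x y ==> (f x != f y)] &&
  [forall i, forall x, forall y, F i x && F i y ==> (f x == f y)].
(* Initial coloring: each family takes a chosen member as its color, every other vertex is its own
   color. *)
pose f0 : {ffun T -> T} :=
  [ffun x => if [pick i | F i x] is Some i
             then xchoose (Fne i) else x].
have f0F i x : F i x -> f0 x = xchoose (Fne i).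
  move=> Fix; rewrite ffunE; case: pickP => [j Fjx|/(_ i)]; last by rewrite Fix.
  by rewrite (Finj _ _ _ Fjx Fix).
have f0N x : (forall i, ~~ F i x) -> f0 x = x.
  move=> Fx; rewrite ffunE; case: pickP => [j Fjx|//].
  by have := Fx j; rewrite Fjx.
have good0 : good f0.
  apply/andP; split; apply/forallP; last first.
    move=> i; apply/forallP => x; apply/forallP => y; apply/implyP.
    by case/andP=> Fx Fy; rewrite (f0F _ _ Fx) (f0F _ _ Fy).
  move=> x; apply/forallP => y; apply/implyP => exy; apply/eqP => f0xy.
  have [/existsP[i Fix]|/existsPn Fx] := boolP [exists i, F i x].
    have [/existsP[j Fjy]|/existsPn Fy] := boolP [exists j, F j y].
      move: f0xy; rewrite (f0F _ _ Fix) (f0F _ _ Fjy) => Eij.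
      have Fij := xchooseP (Fne i); rewrite Eij in Fij.
      have ij := Finj _ _ _ Fij (xchooseP (Fne j)); subst j.
      by have := Find _ _ _ Fix Fjy; rewrite exy.
    move: f0xy; rewrite (f0F _ _ Fix) (f0N _ Fy) => Ey.
    by have := Fy i; rewrite -Ey (xchooseP (Fne i)).
  have [/existsP[j Fjy]|/existsPn Fy] := boolP [exists j, F j y].
    move: f0xy; rewrite (f0F _ _ Fjy) (f0N _ Fx) => Ex.
    by have := Fx j; rewrite Ex (xchooseP (Fne j)).
  move: f0xy exy; rewrite (f0N _ Fx) (f0N _ Fy) => ->.
  exact/negP.
pose im (f : {ffun T -> T}) := [set f x | x in T]%SET.
case: (arg_minnP (fun f => #|im f|) good0) => f /andP[/forallP fprop /forallP fF] fmin.
have fp x y : e x y -> f x != f y.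
  by move=> exy; have /forallP/(_ y)/implyP/(_ exy) := fprop x.
have fcst i x y : F i x -> F i y -> f x = f y.
  move=> Fx Fy; have /forallP/(_ x)/forallP/(_ y) := fF i.
  by rewrite Fx Fy /= => /eqP.
have imf x : f x \in im f by apply/imsetP; exists x.
have fcomplete a b : a \in im f -> b \in im f -> a != b ->
    exists x y, [/\ e x y, f x = a & f y = b].
  move=> /imsetP[xa _ Ea] bim ab.
  have [/existsP[x /existsP[y /and3P[exy /eqP fx /eqP fy]]]|] :=
    boolP [exists x, exists y, [&& e x y, f x == a & f y == b]].
    by exists x, y.
  move=> /existsPn nab.
  have nab' x y : e x y -> f x = a -> f y = b -> False.
    move=> exy fx fy; have /existsPn/(_ y) := nab x.
    by rewrite exy fx fy !eqxx.
  (* Recoloring [b] as [a] keeps the coloring good and loses a color, against minimality. *)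
  pose g : {ffun T -> T} := [ffun x => if f x == b then a else f x].
  have : good g.
    apply/andP; split; apply/forallP; last first.
      move=> i; apply/forallP => x; apply/forallP => y; apply/implyP.
      by case/andP=> Fx Fy; rewrite !ffunE (fcst _ _ _ Fx Fy).
    move=> x; apply/forallP => y; apply/implyP => exy; rewrite !ffunE.
    have := fp _ _ exy.
    case: (eqVneq (f x) b) => [Ex|nx]; case: (eqVneq (f y) b) => [Ey|ny] //.
    - by rewrite Ex Ey eqxx.
    - move=> _; apply/eqP => Ey.
      by apply: (@nab' y x) => //; rewrite esym.
    - by move=> _; apply/eqP => Ex; apply: (@nab' x y).
  move/fmin; rewrite leqNgt => /negP[].
  apply: proper_card; apply/properP; split.
    apply/fintype.subsetP => _ /imsetP[x _ ->]; rewrite ffunE.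
    by case: ifP => _; rewrite ?Ea.
  exists b => //; apply/negP => /imsetP[x _]; rewrite ffunE.
  case: (eqVneq (f x) b) => [_ E|nx E]; first by rewrite E eqxx in ab.
  by rewrite E eqxx in nx.
have lT : (#|im f| < #|T|.+1)%N by rewrite ltnS max_card.
have leI : (#|I| <= #|im f|)%N.
  (* An edge between two families forces their colors apart. *)
  pose r i := f (xchoose (Fne i)).
  have rinj : injective r.
    move=> i j rij; apply/eqP; apply/negPn/negP => /Fcross[x [y [Fx Fy /fp]]].
    rewrite (fcst _ _ _ Fx (xchooseP (Fne i))).
    by rewrite (fcst _ _ _ Fy (xchooseP (Fne j))) -/(r i) rij eqxx.
  rewrite -cardsT -(card_imset _ rinj) subset_leq_card //.
  by apply/fintype.subsetP => _ /imsetP[i _ ->]; apply: imf.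
apply: leq_trans leI _; rewrite /achromatic_number.
apply: (@leq_bigmax_cond _ _ _ (Ordinal lT)) => /=.
apply/existsP; exists [ffun x => enum_rank_in (imf x) (f x)].
have rankE x : enum_val (enum_rank_in (imf x) (f x)) = f x by rewrite enum_rankK_in.
have rank_f x (i : 'I_#|im f|) : f x = enum_val i -> enum_rank_in (imf x) (f x) = i.
  by move=> E; apply: enum_val_inj; rewrite rankE.
apply/and3P; split.
- apply/forallP => i; have /imsetP[x _ E] := enum_valP i.
  by apply/existsP; exists x; rewrite ffunE (rank_f x i).
- apply/forallP => x; apply/forallP => y; apply/implyP => /fp fxy.
  rewrite !ffunE; apply: contra_neq fxy => E.
  by rewrite -rankE -[f y]rankE E.
- apply/forallP => i; apply/forallP => j; apply/implyP => ij.
  have [|x [y [exy fx fy]]] := fcomplete _ _ (enum_valP i) (enum_valP j).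
    by rewrite (inj_eq enum_val_inj).
  apply/existsP; exists x; apply/existsP; exists y.
  by rewrite exy !ffunE (rank_f x i) // (rank_f y j) // !eqxx.
Qed.

(** * A design of triangles and a matching *)

(* Color each cycle of [f] alternately; on an odd cycle one point is left out. *)
Lemma alternate_cycles (T : finType) (f : T -> T) :
  injective f ->
  exists S1 S2 : {set T},
    [/\ forall x, x \in S1 -> f x \notin S1,
        forall x, x \in S2 -> f x \notin S2,
        forall x, x \in S1 -> x \notin S2
      & (7 * #|T| <= 7 * (#|S1| + #|S2|) + #|T| +
           7 * #|[set x | [|| iter 1 f x == x, iter 3 f x == x | iter 5 f x == x]]%SET|)%N].
Proof.
(* [r x] is a base point on the cycle of [x], and [idx x] counts the steps from it to [x]. *)
move=> finj; pose r := froot f; pose idx x := findex f (r x) x.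
have rx x : fconnect f (r x) x.
  by rewrite fconnect_sym //; apply: connect_root.
have rf x : r (f x) = r x.
  by apply/esym/(fingraph.rootP (fconnect_sym finj)); apply: fconnect1.
have idx_lt x : (idx x < order f (r x))%N by apply: findex_max.
have it x : iter (idx x) f (r x) = x by apply: iter_findex.
have iter_order x : iter (order f x) f x = x by apply: fingraph.iter_order.
have idx_f x : idx (f x) = if (idx x).+1 == order f (r x) then 0%N else (idx x).+1.
  case: eqP => [E|/eqP nE].
    apply/eqP; rewrite /idx rf findex_eq0.
    by rewrite -[x in f x]it -iterS E iter_order.
  rewrite /idx rf -[x in f x]it -iterS findex_iter //.
  by rewrite ltn_neqAle nE idx_lt.
(* Even positions go to [S1], odd ones to [S2]. The last position is even exactly on odd cycles;
   there [S1] skips it, because the base point comes next. *)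
exists [set x | ~~ odd (idx x) & (idx x).+1 != order f (r x)]%SET.
exists [set x | odd (idx x)]%SET.
set S1 := finset _; set S2 := finset _; split.
- by move=> x; rewrite !inE idx_f => /andP[ev /negPf->] /=; rewrite ev.
- move=> x; rewrite !inE idx_f => od; case: ifP => //= _.
  by rewrite od.
- by move=> x; rewrite !inE => /andP[].
set B := finset _.
pose U := (~: (S1 :|: S2))%SET.
have UE x : x \in U -> ~~ odd (idx x) /\ (idx x).+1 = order f (r x).
  by rewrite !inE negb_or negb_and !negbK; case: odd => //= /andP[/eqP].
have ordU x : x \in U -> order f x = (idx x).+1.
  move=> /UE[_ ->]; apply: eq_card => y.
  by rewrite !inE; apply: same_connect; [apply: fconnect_sym|rewrite fconnect_sym].
(* A point of [U] lies on an odd cycle, and length 1, 3 or 5 would put it in [B]. *)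
have UB x : x \in (U :\: B)%SET -> (7 <= order f x)%N.
  rewrite inE => /andP[xB xU]; rewrite leqNgt; apply: contra xB => o7.
  have [ev _] := UE _ xU; have oE := ordU _ xU; have := iter_order x.
  rewrite inE oE; rewrite oE in o7.
  by case: (idx x) ev o7 => [|[|[|[|[|[|?]]]]]] // _ _ ->; rewrite eqxx ?orbT.
(* Each odd cycle has a single point in [U]. Outside [B], seven successive iterates from each such
   point never coincide, so these points are at most a seventh of [T]. *)
pose g (p : {x | x \in (U :\: B)%SET} * 'I_7) := iter p.2 f (val p.1).
have ginj : injective g.
  move=> [[x xU] i] [[y yU] j]; rewrite /g /= => E.
  have riter z k : r (iter k f z) = r z by elim: k => //= k; rewrite rf.
  have rxy : r x = r y by rewrite -(riter x i) E riter.
  have [_ Ex] : ~~ odd (idx x) /\ (idx x).+1 = order f (r x).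
    by apply: UE; case/setDP: xU.
  have [_ Ey] : ~~ odd (idx y) /\ (idx y).+1 = order f (r y).
    by apply: UE; case/setDP: yU.
  have xy : x = y.
    rewrite -(it x) -(it y) rxy; congr iter.
    by apply: succn_inj; rewrite Ex Ey rxy.
  subst y; congr pair; first exact: val_inj.
  apply: val_inj => /=.
  have o7 := UB _ xU.
  rewrite -(@findex_iter _ f x i) ?(leq_trans (ltn_ord i)) //.
  by rewrite E findex_iter ?(leq_trans (ltn_ord j)).
have le7 : (#|U :\: B|%SET * 7 <= #|T|)%N.
  have := leq_card _ ginj; rewrite card_prod card_ord card_sig.
  by congr (_ * 7 <= _)%N; apply: eq_card.
have leU : (#|U| <= #|U :\: B|%SET + #|B|)%N.
  by rewrite -(cardsID B U) addnC leq_add2l subset_leq_card // subsetIr.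
have : (#|S1 :|: S2|%SET + #|U| = #|T|)%N by rewrite cardsC.
have : (#|S1 :|: S2|%SET <= #|S1| + #|S2|)%N by rewrite cardsU leq_subr.
by move: le7 leU; lia.
Qed.

(** Two members of a zero-sum triple determine the third, so distinct triples share at most one
    point. *)
Lemma zero_sum_triple (G : finZmodType) (A : {set G}) (x y : G) :
  #|A| = 3 -> \sum_(z in A) z = 0 -> x \in A -> y \in A -> x != y ->
  [/\ A = [set x; y; - (x + y)]%SET, - (x + y) != x & - (x + y) != y].
Proof.
move=> A3 A0 xA yA xy.
have yA' : y \in (A :\ x)%SET by rewrite !inE eq_sym xy.
have /cards1P[z Ez] : #|(A :\ x :\ y)%SET| == 1%N.
  by move: A3; rewrite (cardsD1 x) (cardsD1 y (A :\ x)%SET) xA yA'; lia.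
have := A0; rewrite (big_setD1 x) //= (big_setD1 y) //= Ez big_set1 addrA => E.
have -> : - (x + y) = z by apply/eqP; rewrite eq_sym -addr_eq0 addrC E.
have : z \in (A :\ x :\ y)%SET by rewrite Ez inE.
rewrite !inE => /and3P[zy zx zA]; split => //.
by rewrite -(finset.setD1K xA) -(finset.setD1K yA') Ez finset.setUA.
Qed.

Lemma card_off_diagonal (T : finType) (A : {set T}) :
  (#|[set p : T * T | [&& p.1 \in A, p.2 \in A & p.1 != p.2]]%SET| = #|A| * #|A|.-1)%N.
Proof.
set D := finset _.
have -> : D = (finset.setX A A :\: [set (x, x) | x in A])%SET.
  apply/setP => -[x y]; rewrite !inE /=.
  case: (boolP (x \in A)) => xA; case: (boolP (y \in A)) => yA;
    rewrite ?andbF //= andbT.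
  congr (~~ _); apply/eqP/imsetP => [->|[z _ [-> ->]]] //.
  by exists y.
rewrite cardsD cardsX (finset.setIidPr _); last first.
  by apply/fintype.subsetP => _ /imsetP[x xA ->]; rewrite inE /= xA.
rewrite card_imset; last by move=> ? ? [].
by case: #|A| => [|k] //=; rewrite mulSn mulnS; lia.
Qed.

Lemma card_bigcup_le (I T : finType) (P : pred I) (F : I -> {set T}) :
  (#|\bigcup_(i | P i) F i|%SET <= \sum_(i | P i) #|F i|)%N.
Proof.
elim/big_rec2: _ => [|i n A _ le]; first by rewrite cards0.
by rewrite (leq_trans (leq_card_setU _ _).1) // leq_add2l.
Qed.

(** Complete each ordered pair (x, y) by -(x + y). Every triple arises from six pairs; the
    degenerate pairs satisfy x = y, y = -2x or x = -2y, which gives at most three per element of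
    [G]. *)
Lemma card_zero_sum_triples (G : finZmodType) :
  (#|G| * #|G| <=
     6 * #|[set A : {set G} | (#|A| == 3%N) && (\sum_(x in A) x == 0)%R]%SET| +
     3 * #|G|)%N.
Proof.
set Z := finset _.
pose P := [set p : G * G |
  [&& p.1 != p.2, - (p.1 + p.2) != p.1 & - (p.1 + p.2) != p.2]]%SET.
have leP : (#|P| <= 6 * #|Z|)%N.
  pose D (A : {set G}) := [set p : G * G | [&& p.1 \in A, p.2 \in A & p.1 != p.2]]%SET.
  have sub : P \subset (\bigcup_(A in Z) D A)%SET.
    apply/fintype.subsetP => -[x y]; rewrite inE /= => /and3P[xy zx zy].
    apply/finset.bigcupP; exists [set x; y; - (x + y)]%SET; last first.
      by rewrite !inE /= xy !eqxx ?orbT.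
    have [xz yz] : x != - (x + y) /\ y != - (x + y) by rewrite ![_ == - _]eq_sym.
    rewrite inE -finset.setUA cardsU1 cards2 !inE negb_or xy xz yz eqxx /=.
    rewrite big_setU1 ?inE ?negb_or ?xy ?xz //=.
    by rewrite big_setU1 ?inE //= big_set1 addrA subrr.
  apply: leq_trans (subset_leq_card sub) _.
  apply: leq_trans (card_bigcup_le _ _) _.
  rewrite mulnC -sum_nat_const leq_sum // => A; rewrite inE => /andP[/eqP A3 _].
  by rewrite card_off_diagonal A3.
have leC : (#|~: P|%SET <= 3 * #|G|)%N.
  have sub : ~: P \subset ([set (x, x) | x in G] :|:
     ([set (x, - (x + x)) | x in G] :|: [set (- (x + x), x) | x in G]))%SET.
    apply/fintype.subsetP => -[x y]; rewrite !inE /= !negb_and !negbK.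
    case/or3P => /eqP E; apply/orP.
    - by left; apply/imsetP; exists x; rewrite // -E.
    - right; apply/orP; left; apply/imsetP; exists x => //; congr pair.
      by rewrite -[X in - (X + _)]E opprD opprK addrC addKr.
    - right; apply/orP; right; apply/imsetP; exists y => //; congr pair.
      by rewrite -[X in - (X + _)]E opprD opprK addrK.
  apply: leq_trans (subset_leq_card sub) _.
  apply: leq_trans (leq_card_setU _ _).1 _.
  rewrite !mulSn mul0n addn0 leq_add ?leq_imset_card //.
  apply: leq_trans (leq_card_setU _ _).1 _.
  by rewrite leq_add ?leq_imset_card.
by rewrite -card_prod -(cardsC P) leq_add.
Qed.

(** If [m.+1] divides xk, then x is determined by the quotient, which is less than k. *)
Lemma card_Zp_torsion (m k : nat) :
  (0 < k)%N -> (#|[set x : 'I_m.+1 | (x *+ k == 0)%R]%SET| <= k)%N.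
Proof.
case: k => // k _.
have dvd (x : 'I_m.+1) : x *+ k.+1 == 0 -> (m.+1 %| x * k.+1)%N.
  by rewrite Zp_mulrn -val_eqE.
pose g (x : 'I_m.+1) : 'I_k.+1 := inord ((x * k.+1) %/ m.+1).
rewrite -[X in (_ <= X)%N]card_ord -(@card_in_imset _ _ g) ?max_card // => x y.
rewrite !inE => /dvd dx /dvd dy.
have lt (z : 'I_m.+1) : ((z * k.+1) %/ m.+1 < k.+1)%N.
  by rewrite ltn_divLR // mulnC ltn_pmul2l.
move/(congr1 (@nat_of_ord _)); rewrite /g !inordK ?lt // => E.
apply: val_inj; apply/eqP; rewrite -(eqn_pmul2r (ltn0Sn k)).
by rewrite -(divnK dx) -(divnK dy) E.
Qed.

(** Here the odd modulus is [m.+1], the point oo is [None], and [m.+2] is the number of points. [I]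
    indexes the triangles and [J] the future sides; the conditions on [u] and [v] make the sides
    pairwise disjoint, so that all of them fit on the polygon at once. *)
Lemma triangle_matching_design (m : nat) :
  ~~ odd m ->
  exists (I J : finType) (b : I -> {set option 'I_m.+1})
         (u v : J -> option 'I_m.+1),
    let block k := match k with inl i => b i | inr j => [set u j; v j]%SET end in
    [/\ forall i, #|b i| = 3,
        [/\ injective u, injective v & forall j j', u j != v j'],
        forall k k' x y, x != y -> x \in block k -> y \in block k ->
          x \in block k' -> y \in block k' -> k = k'
      & (7 * m.+2 ^ 2 + m.+2 <= 42 * (#|I| + #|J|) + 1898)%N].
Proof.
move=> m_even; pose G := 'I_m.+1; pose f (x : G) : G := - (x *+ 2).
have torsion (x : G) : x *+ m.+1 = 0.
  by rewrite Zp_mulrn; apply: val_inj; rewrite /= modnMl.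
have finj : injective f.
  (* Doubling is invertible modulo the odd number [m.+1]. *)
  have half (x : G) : x = - (x *+ 2 *+ m./2).
    apply/eqP; rewrite -addr_eq0 -mulrnA -[X in X + _]mulr1n -mulrnDr add1n.
    by rewrite mul2n even_halfK // torsion.
  by move=> x y /oppr_inj E; rewrite (half x) (half y) E.
have [S1 [S2 [fS1 fS2 S12 le_S]]] := alternate_cycles finj.
pose Z := [set A : {set G} | (#|A| == 3%N) && (\sum_(x in A) x == 0)]%SET.
pose I : finType := ({A | A \in Z} + {x | x \in S1})%type.
pose J : finType := {x | x \in S2}.
pose b (i : I) : {set option G} := match i with
  | inl A => [set Some x | x in val A]%SET
  | inr a => [set None; Some (val a); Some (f (val a))]%SET end.
pose u (j : J) : option G := Some (val j).
pose v (j : J) : option G := Some (f (val j)).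
exists I, J, b, u, v => block.
have nfix1 a : a \in S1 -> f a != a.
  by move=> aS; apply: contraNneq (fS1 _ aS) => ->.
have nfix2 a : a \in S2 -> f a != a.
  by move=> aS; apply: contraNneq (fS2 _ aS) => ->.
(* No cycle has length 2: 4a = a gives 3a = 0, hence -2a = a. So the unordered pair {a, f a}
   determines a. *)
have ff a : f (f a) = a -> f a = a.
  rewrite /f mulNrn opprK -mulrnA => E.
  have a3 : a *+ 3 = 0 by apply: (addrI a); rewrite -mulrS addr0 E.
  by apply/eqP; rewrite eq_sym -addr_eq0 -mulrS a3.
pose R a x y := (x = a /\ y = f a) \/ (y = a /\ x = f a).
have R_uniq a a' x y : f a != a -> R a x y -> R a' x y -> a = a'.
  move=> nfix [[-> ->]|[-> ->]] [[E1 E2]|[E1 E2]] //;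
    by case/eqP: nfix; apply: ff; rewrite E1 -E2.
(* The possible pairs inside each kind of block. Those of a zero-sum triple are never of the form
   {z, f z}, which leaves such pairs to the other two kinds. *)
pose Q (k : I + J) p q := match k with
  | inl (inl A) => exists x y, [/\ p = Some x, q = Some y,
       val A = [set x; y; - (x + y)]%SET, y != f x & x != f y]
  | inl (inr a) => (exists2 z, z = val a \/ z = f (val a) &
         p = None /\ q = Some z \/ q = None /\ p = Some z) \/
       exists x y, [/\ p = Some x, q = Some y & R (val a) x y]
  | inr c => exists x y, [/\ p = Some x, q = Some y & R (val c) x y] end.
have blockQ k p q : p != q -> p \in block k -> q \in block k -> Q k p q.
  case: k => [[[A AZ]|[a aS]]|[c cS]] pq /=.
  - move=> /imsetP[x xA Ep] /imsetP[y yA Eq]; rewrite {}Ep {}Eq in pq *.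
    move: AZ; rewrite inE => /andP[/eqP A3 /eqP A0].
    have xy : x != y by apply: contraNneq pq => ->.
    have [EA zx zy] := zero_sum_triple A3 A0 xA yA xy.
    exists x, y; split => //.
      apply: contraNneq zx => ->; rewrite /f.
      by rewrite mulr2n opprB addrK.
    apply: contraNneq zy => ->; rewrite /f.
    by rewrite mulr2n opprD opprK addrK.
  - rewrite !inE -!orbA => /or3P[]/eqP Ep /or3P[]/eqP Eq; rewrite {}Ep {}Eq in pq *;
      try by rewrite eqxx in pq.
    + by left; exists a; [left|left].
    + by left; exists (f a); [right|left].
    + by left; exists a; [left|right].
    + by right; exists a, (f a); split=> //; left.
    + by left; exists (f a); [right|right].
    + by right; exists (f a), a; split=> //; right.
  - rewrite !inE => /orP[]/eqP Ep /orP[]/eqP Eq; rewrite {}Ep {}Eq in pq *;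
      try by rewrite eqxx in pq.
    + by exists c, (f c); split=> //; left.
    + by exists (f c), c; split=> //; right.
have notR a x y : y != f x -> x != f y -> R a x y -> False.
  by move=> yx xy [[Ex Ey]|[Ey Ex]]; [case/eqP: yx|case/eqP: xy]; rewrite Ex Ey.
have Quniq k k' p q : Q k p q -> Q k' p q -> k = k'.
  case: k => [[[A AZ]|[a aS]]|[c cS]]; case: k' => [[[A' AZ']|[a' aS']]|[c' cS']] /=.
  - move=> [x [y [-> -> EA _ _]]] [x' [y' [[<-] [<-] EA' _ _]]].
    by congr (inl (inl _)); apply: val_inj; rewrite /= EA EA'.
  - move=> [x [y [-> -> _ yx xy]]] [[z _ [] []//]|[x' [y' [[<-] [<-]]]]].
    by move/(notR _ _ _ yx xy).
  - move=> [x [y [-> -> _ yx xy]]] [x' [y' [[<-] [<-]]]].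
    by move/(notR _ _ _ yx xy).
  - move=> H [x [y [Ep Eq _ yx xy]]]; move: H; rewrite Ep Eq.
    move=> [[z _ [] []//]|[x' [y' [[<-] [<-]]]]].
    by move/(notR _ _ _ yx xy).
  - move=> H1 H2; congr (inl (inr _)); apply: val_inj => /=.
    move: H2; case: H1 => [[z za Ez] H2|[x [y [-> -> Ra]]]]; last first.
      case=> [[z _ [] []//]|[x' [y' [[<-] [<-] Ra']]]].
      by apply: R_uniq Ra Ra'; apply: nfix1.
    (* The common edge now joins oo to some z in both {a, f a} and {a', f a'}. Unless a = a', one of
       a, a' is the image of the other, which [fS1] forbids. *)
    case: H2 => [[z' za' Ez']|[x [y [Ep Eq _]]]]; last by case: Ez; rewrite Ep Eq => -[].
    have zz' : z = z' by move: Ez'; case: Ez => -[-> ->] [[E1 E2]|[E1 E2]] //; case: E2.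
    move: za za'; rewrite -zz' => -[->|->] [] //; last by move/finj.
      by move=> E; case/negP: (fS1 _ aS'); rewrite -E.
    by move=> E; case/negP: (fS1 _ aS); rewrite E.
  - move=> H [x [y [Ep Eq Rc]]]; move: H; rewrite Ep Eq.
    case=> [[z _ [] []//]|[x' [y' [[<-] [<-] Ra]]]].
    have E : a = c' by apply: R_uniq Ra Rc; apply: nfix1.
    by case/negP: (S12 _ aS); rewrite E.
  - move=> H [x [y [Ep Eq _ yx xy]]]; move: H; rewrite Ep Eq.
    move=> [x' [y' [[<-] [<-]]]].
    by move/(notR _ _ _ yx xy).
  - move=> [x [y [-> -> Rc]]].
    case=> [[z _ [] []//]|[x' [y' [[<-] [<-] Ra]]]].
    have E : a' = c by apply: R_uniq Ra Rc; apply: nfix1.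
    by case/negP: (S12 _ aS'); rewrite E.
  - move=> [x [y [-> -> Rc]]] [x' [y' [[<-] [<-] Rc']]].
    congr inr; apply: val_inj => /=.
    by apply: R_uniq Rc Rc'; apply: nfix2.
split.
- case=> [[A AZ]|[a aS]] /=.
    rewrite card_imset; last by move=> ? ? [].
    by move: AZ; rewrite inE => /andP[/eqP].
  rewrite -finset.setUA cardsU1 cards2 !inE /=.
  by rewrite (inj_eq Some_inj) eq_sym nfix1.
- split.
  + by move=> x y /Some_inj/val_inj.
  + by move=> x y /Some_inj/finj/val_inj.
  + move=> [x xS] [y yS]; apply/eqP => /Some_inj E.
    by case/negP: (fS2 _ yS); rewrite -E.
- move=> k k' p q pq pk qk pk' qk'.
  exact: Quniq (blockQ _ _ _ pq pk qk) (blockQ _ _ _ pq pk' qk').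
have cI : #|I| = (#|Z| + #|S1|)%N.
  by rewrite card_sum !card_sig; congr addn; apply: eq_card.
have cJ : #|J| = #|S2| by rewrite card_sig; apply: eq_card.
have itf (x : G) k : - (x *+ k) == x -> x *+ k.+1 == 0.
  by rewrite mulrS addr_eq0 eq_sym.
(* The first, third and fifth iterates of [f] multiply by -2, -8 and -32; their fixed points number
   at most 3, 9 and 33. *)
have leB : (#|[set x | [|| iter 1 f x == x, iter 3 f x == x | iter 5 f x == x]]%SET| <= 45)%N.
  apply: (@leq_trans #|[set x : G | (x *+ 3 == 0)%R] :|: ([set x : G | (x *+ 9 == 0)%R]
             :|: [set x : G | (x *+ 33 == 0)%R])|%SET).
    apply/subset_leq_card/fintype.subsetP => x; rewrite !inE /= /f.
    rewrite !(mulNrn, opprK) -!mulrnA => /or3P[]/itf-> //; by rewrite ?orbT.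
  apply: leq_trans (leq_card_setU _ _).1 _.
  apply: (@leq_trans (3 + (9 + 33))) => //; apply: leq_add; first exact: card_Zp_torsion.
  apply: leq_trans (leq_card_setU _ _).1 _.
  by apply: leq_add; apply: card_Zp_torsion.
(* With g = m + 1, the two counts give 42(z + s1 + s2) >= 7(g^2 - 3g) + 36g - 42 * 45 = 7g^2 + 15g -
   1890, while 7(g + 1)^2 + (g + 1) = 7g^2 + 15g + 8; hence 1898. *)
have := card_zero_sum_triples G; rewrite -/Z.
move: le_S leB; rewrite cI cJ !card_ord.
move: (#|Z|) (#|S1|) (#|S2|) => z s1 s2.
set B := (X in (X <= 45)%N).
rewrite -/B -mulnn; move: B => B; lia.
Qed.

(** * Points in convex position *)

Section ConvexPosition.
Local Open Scope convex_scope.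
Variable R : realType.
Local Notation plane := 'rV[R]_2.
Implicit Types (a b c p u v : plane) (V : {fset plane}).

(** Twice the signed area of the triangle abc, positive when it is counterclockwise. *)
Definition orient a b c : R :=
  (b 0 0 - a 0 0) * (c 0 1 - a 0 1) - (b 0 1 - a 0 1) * (c 0 0 - a 0 0).

Lemma plane_eq a b : a 0 0 = b 0 0 -> a 0 1 = b 0 1 -> a = b.
Proof.
move=> e0 e1; apply/rowP => -[[|[|//]] i] /=.
  by rewrite (_ : Ordinal i = 0) //; apply: val_inj.
by rewrite (_ : Ordinal i = 1) //; apply: val_inj.
Qed.

Lemma conv_plane a b (t : {i01 R}) :
  (a : convex_lmodType plane) <| t |> b = t%:num *: a + (1 - t%:num) *: b.
Proof. by []. Qed.

Lemma orient_eq0_collinear a b c : a != b -> orient a b c = 0 -> collinear a b c.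
Proof.
move=> ab; rewrite /orient => E; exists a, (b - a) => x.
rewrite !inE => /or3P[]/eqP->.
- by exists 0; rewrite scale0r addr0.
- by exists 1; rewrite scale1r addrC subrK.
have [b0|nb0] := eqVneq (b 0 0 - a 0 0) 0.
  have nb1 : b 0 1 - a 0 1 != 0.
    apply: contra_neq ab => b1; apply: plane_eq; apply/esym/eqP.
      by rewrite -subr_eq0 b0.
    by rewrite -subr_eq0 b1.
  exists ((c 0 1 - a 0 1) / (b 0 1 - a 0 1)); apply: plane_eq; rewrite !mxE; last by field.
  rewrite b0 mulr0 addr0; apply/eqP; rewrite -subr_eq0.
  move/eqP: E; rewrite b0 mul0r sub0r oppr_eq0 mulf_eq0 (negPf nb1) /=.
  by [].
exists ((c 0 0 - a 0 0) / (b 0 0 - a 0 0)); apply: plane_eq; rewrite !mxE; first by field.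
rewrite -[LHS](subrK (a 0 1)) addrC; congr (_ + _).
rewrite mulrAC [X in _ = X / _]mulrC; apply: (canRL (mulfK nb0)).
by move: E; lra.
Qed.

Lemma convex_polygon_convex (P : set plane) : convex_polygon P ->
  forall a b (t : {i01 R}), P a -> P b ->
    P ((a : convex_lmodType plane) <| t |> b).
Proof.
move=> [S _ ->] a b t Sa Sb M [cM SM].
by apply/set_mem/cM; apply/mem_set; [apply: Sa|apply: Sb].
Qed.

(** The three areas are barycentric coordinates of [p] up to scaling. They place [p] strictly
    between [a] and a point [w] of the segment bc, so extremality forces a = w and hence p = a. *)
Lemma polygon_vertex_not_inside (P : set plane) a b c p :
  convex_polygon P -> polygon_vertices P p -> P a -> P b -> P c ->
  p != a -> 0 < orient p b c -> 0 < orient a p c -> 0 < orient a b p -> False.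
Proof.
move=> /convex_polygon_convex cP [_ ext] Pa Pb Pc pa.
set A := orient p b c; set B := orient a p c; set C := orient a b p => A0 B0 C0.
have BC0 : 0 < B + C by rewrite addr_gt0.
have ABC0 : 0 < A + (B + C) by rewrite addr_gt0.
have [t0 t1] : 0 <= B / (B + C) /\ B / (B + C) <= 1.
  split; first by rewrite divr_ge0 // ltW.
  by rewrite ler_pdivrMr // mul1r lerDl ltW.
have [s0 s1] : 0 < A / (A + (B + C)) /\ A / (A + (B + C)) < 1.
  by split; [rewrite divr_gt0|rewrite ltr_pdivrMr // mul1r ltrDl].
pose t := Itv01 t0 t1; pose s := Itv01 (ltW s0) (ltW s1).
have Pw := cP _ _ t Pb Pc.
set w := (X in P X) in Pw.
have pE : (a : convex_lmodType plane) <| s |> w = p.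
  apply: plane_eq; rewrite /w !conv_plane !mxE /=; apply/eqP;
    rewrite -subr_eq0; apply/eqP;
    apply: (mulfI (lt0r_neq0 ABC0)); rewrite mulr0;
    move: (lt0r_neq0 ABC0) (lt0r_neq0 BC0); rewrite /A /B /C /orient => n1 n2;
    by field; rewrite n1 n2.
have aw := ext _ _ s Pa Pw s0 s1 pE.
by case/eqP: pa; rewrite -pE -aw convmm.
Qed.

(** Convex position enters the rest of the proof only in this form: general position, and no point
    strictly inside a triangle of others. *)
Lemma convex_position_orient V : convex_position V ->
  (forall a b c, a \in V -> b \in V -> c \in V -> uniq [:: a; b; c] ->
     orient a b c != 0) /\
  (forall a b c p, a \in V -> b \in V -> c \in V -> p \in V ->
     p != a -> 0 < orient p b c -> 0 < orient a p c -> 0 < orient a b p -> False).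
Proof.
move=> [ncol [P cP EV]]; split => [a b c aV bV cV abc|a b c p aV bV cV pV].
  apply/eqP => E; apply: (ncol a b c) => //; apply: orient_eq0_collinear E.
  by move: abc; rewrite /= inE negb_or => /andP[/andP[]].
have vV x : x \in V -> polygon_vertices P x by rewrite EV.
apply: (polygon_vertex_not_inside cP); [exact: vV|..].
- by case: (vV _ aV).
- by case: (vV _ bV).
- by case: (vV _ cV).
Qed.

Lemma orientC a b c : orient b a c = - orient a b c.
Proof. by rewrite /orient; ring. Qed.

Lemma orient_rot a b c : orient b c a = orient a b c.
Proof. by rewrite /orient; ring. Qed.

(* Sort the points by angle around one of them. *)
Lemma convex_position_sorted V : convex_position V ->
  exists s : seq plane, [/\ uniq s, s =i V &
    forall i j k, (i < j < k)%N -> (k < size s)%N ->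
      0 < orient (nth 0 s i) (nth 0 s j) (nth 0 s k)].
Proof.
move=> /convex_position_orient[gen ext].
have [s0 us0 s0V] : exists2 s : seq plane, uniq s & s =i V.
  by exists (enum_fset V) => //; apply: fset_uniq.
case: s0 us0 s0V => [|o r] us0 s0V; first by exists [::].
have oV : o \in V by rewrite -s0V mem_head.
have rV x : x \in r -> x \in V by move=> xr; rewrite -s0V inE xr orbT.
have [or ur] : o \notin r /\ uniq r by move: us0 => /= /andP.
have ro x : x \in r -> x != o by apply: contraTneq => ->.
pose le x y := (x == y) || (0 < orient o x y).
have le_total : {in mem r &, total le}.
  move=> x y xr yr; rewrite /le [y == x]eq_sym; case: eqVneq => //= xy.
  have := gen o x y oV (rV _ xr) (rV _ yr).
  rewrite /= !inE negb_or eq_sym ro // eq_sym ro // xy => /(_ isT).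
  rewrite [orient o y x](_ : _ = - orient o x y); last by rewrite /orient; ring.
  by rewrite oppr_gt0 neq_lt orbC.
(* If transitivity failed, x, y, z would wind once around [o], putting [o] strictly inside their
   triangle. *)
have le_trans : {in mem r & &, transitive le}.
  move=> y x z yr xr zr; rewrite /le.
  case: (eqVneq x y) => [-> //|xy] /=; case: (eqVneq y z) => [<-|yz] /=.
    by move=> ->; rewrite orbT.
  case: (eqVneq x z) => //= xz oxy oyz.
  have := gen o x z oV (rV _ xr) (rV _ zr).
  rewrite /= !inE negb_or eq_sym ro // eq_sym ro // xz => /(_ isT).
  rewrite neq_lt => /orP[oxz|//]; exfalso.
  apply: (ext x y z o (rV _ xr) (rV _ yr) (rV _ zr) oV) => //.
  - by rewrite eq_sym ro.
  - by rewrite orientC oppr_gt0.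
  - by rewrite orient_rot.
have rr : all (mem r) r by apply/allP.
have sP := sort_sorted_in le_total rr.
pose r' := path.sort le r.
have mem_r' : r' =i r by apply: mem_sort.
have ur' : uniq r' by rewrite sort_uniq.
have rr' : all (mem r) r' by apply/allP => x; rewrite /= mem_r'.
have nthr i : (i < size r')%N -> nth 0 r' i \in r by move=> ?; rewrite -mem_r' mem_nth.
have lt_orient i j : (i < j < size r')%N -> 0 < orient o (nth 0 r' i) (nth 0 r' j).
  move=> /andP[ij jr]; have ir := ltn_trans ij jr.
  have := sorted_ltn_nth_in le_trans 0 rr' sP i j ir jr ij.
  by rewrite /le nth_uniq // ltn_eqF.
exists (o :: r'); split.
- by rewrite /= mem_r' or.
- by move=> x; rewrite -s0V !inE mem_r'.
move=> [|i] [|j] [|k] //=; rewrite !ltnS => ijk kr.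
- by apply: lt_orient; rewrite ijk.
- by case/andP: ijk.
have [ij jk] := andP ijk.
have jr : (j < size r')%N by apply: ltn_trans kr.
have ir : (i < size r')%N by apply: ltn_trans jr.
have := gen _ _ _ (rV _ (nthr _ ir)) (rV _ (nthr _ jr)) (rV _ (nthr _ kr)).
rewrite /= !inE !nth_uniq // negb_or (ltn_eqF ij) (ltn_eqF jk).
rewrite (ltn_eqF (ltn_trans ij jk)) => /(_ isT).
(* With the wrong sign, the middle point would lie strictly inside the triangle formed by [o] and
   the other two. *)
rewrite neq_lt => /orP[neg|//]; exfalso.
apply: (ext o _ _ _ oV (rV _ (nthr _ ir)) (rV _ (nthr _ kr)) (rV _ (nthr _ jr))).
- by rewrite ro // nthr.
- by rewrite orientC oppr_gt0.
- by apply: lt_orient; rewrite jk.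
- by apply: lt_orient; rewrite ij.
Qed.

Lemma orient_segment u v a b x : closed_segment a b x ->
  exists2 t : R, 0 <= t <= 1 & orient u v x = t * orient u v a + (1 - t) * orient u v b.
Proof.
move=> [t _ <-]; exists t%:num; first by rewrite ge0 le1.
by rewrite conv_plane /orient !mxE; ring.
Qed.

(** The affine function [orient u v] vanishes on the first segment and keeps a strict sign on the
    second. *)
Lemma disjoint_of_same_side V (s1 s2 : segments V) (u v a b : V) :
  val s1 = [set u; v]%SET -> val s2 = [set a; b]%SET ->
  0 < orient (val u) (val v) (val a) * orient (val u) (val v) (val b) ->
  disjointness_graph s1 s2.
Proof.
move=> E1 E2 ab; apply/disj_setPS => x [[u' [v' [E1' x1]]] [a' [b' [E2' x2]]]].
have [t _ xt] := orient_segment (val u) (val v) x1.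
have [t' /andP[t0 t1] xt'] := orient_segment (val u) (val v) x2.
(* The endpoints found in [segment_points] may come in either order, so the signs are established
   for every member of the pair. *)
have on z : z \in [set u; v]%SET -> orient (val u) (val v) (val z) = 0.
  by rewrite !inE => /orP[]/eqP->; rewrite /orient; ring.
have off z : z \in [set a; b]%SET ->
    0 < orient (val u) (val v) (val a) * orient (val u) (val v) (val z).
  rewrite !inE => /orP[]/eqP-> //.
  rewrite -expr2 exprn_even_gt0 //=.
  by apply: contraTneq ab => ->; rewrite mul0r ltxx.
have := off a'; have := off b'; have := on u'; have := on v'.
rewrite -E1 -E2 E1' E2' !inE !eqxx !orbT => /(_ isT) v0 /(_ isT) u0 /(_ isT) b0 /(_ isT) a0.
move: xt; rewrite v0 u0 !mulr0 addr0 xt' => E.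
move: a0 b0 E; clear -t0 t1.
set p := orient _ _ (val a); set q := orient _ _ _; set r := orient _ _ _.
(* Multiplying by p makes both terms nonnegative whatever the sign of p. *)
move=> pr pq /(congr1 ( *%R p)); rewrite mulr0.
have := t0; rewrite le_eqVlt => /orP[/eqP <- E|tpos E]; first by exfalso; lra.
have h1 : 0 < t' * (p * q) by rewrite mulr_gt0.
have h2 : 0 <= (1 - t') * (p * r) by rewrite mulr_ge0 ?subr_ge0 // ltW.
by exfalso; lra.
Qed.

Lemma common_endpoint_meet V (s1 s2 : segments V) (w : V) :
  w \in val s1 -> w \in val s2 -> ~~ disjointness_graph s1 s2.
Proof.
have on (s : segments V) : w \in val s -> segment_points s (val w).
  move=> ws; have /cards2P[x [y [_ Es]]] := valP s; exists x, y; split => //.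
  move: ws; rewrite Es !inE => /orP[]/eqP->.
    by exists 1%:i01 => //; rewrite conv1.
  by exists 0%:i01 => //; rewrite conv0.
by move=> w1 w2; apply/negP => /disj_setPS/(_ (val w))[]; split; apply: on.
Qed.

End ConvexPosition.

(** * Classes of segments *)

Lemma two_of_same_sign (R : realDomainType) (r s t : R) :
  r != 0 -> s != 0 -> t != 0 -> [\/ 0 < r * s, 0 < s * t | 0 < t * r].
Proof.
rewrite !neq_lt => /orP[r0|r0] /orP[s0|s0] /orP[t0|t0];
  solve [ constructor 1; by [apply: mulr_gt0|rewrite nmulr_rgt0]
        | constructor 2; by [apply: mulr_gt0|rewrite nmulr_rgt0]
        | constructor 3; by [apply: mulr_gt0|rewrite nmulr_rgt0] ].
Qed.

(* The class of a block consists of all edges inside it. *)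
Lemma achromatic_number_blocks (R : realType) (V : {fset 'rV[R]_2})
    (I J : finType) (b : I -> {set V}) (u v : J -> V) :
  let block k := match k with inl i => b i | inr j => [set u j; v j]%SET end in
  (forall x y z : V, uniq [:: x; y; z] -> orient (val x) (val y) (val z) != 0) ->
  (forall i, #|b i| = 3) ->
  injective u -> injective v -> (forall j j', u j != v j') ->
  (forall j x y, x \notin [set u j; v j]%SET -> y \notin [set u j; v j]%SET ->
     0 < orient (val (u j)) (val (v j)) (val x) *
         orient (val (u j)) (val (v j)) (val y)) ->
  (forall k k' x y, x != y -> x \in block k -> y \in block k ->
     x \in block k' -> y \in block k' -> k = k') ->
  (#|I| + #|J| <= achromatic_number (@disjointness_graph R V))%N.
Proof.
move=> block gen b3 uinj vinj uv side lin.
pose F (k : I + J) : pred (segments V) := fun s => val s \subset block k.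
have pair x y : x != y -> {s : segments V | val s = [set x; y]%SET}.
  move=> xy; have c2 : #|[set x; y]%SET| == 2%N by rewrite cards2 xy.
  by exists (exist (fun s : {set V} => #|s| == 2%N) _ c2).
(* Two 2-subsets of a set of at most three points share a point. *)
have meet s1 s2 k : F k s1 -> F k s2 -> ~~ disjointness_graph s1 s2.
  move=> F1 F2; suff [w w1 w2] : exists2 w, w \in val s1 & w \in val s2.
    exact: common_endpoint_meet w1 w2.
  have c : (#|val s1 :|: val s2|%SET <= 3)%N.
    apply: (@leq_trans #|block k|).
      by apply: subset_leq_card; rewrite finset.subUset; apply/andP.
    by case: (k) => [i|j] /=; rewrite ?b3 // cards2; case: (_ != _).
  have : (0 < #|val s1 :&: val s2|%SET)%N.
    have := cardsUI (val s1) (val s2).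
    by rewrite (eqP (valP s1)) (eqP (valP s2)); move: c; lia.
  by case/card_gt0P => w; rewrite inE => /andP[w1 w2]; exists w.
(* A triangle has at most one vertex in any other block, hence two outside it. *)
have outside i k : inl i != k ->
    exists x y, [/\ x \in b i, y \in b i, x != y, x \notin block k & y \notin block k].
  move=> ik; have : (1 < #|b i :\: block k|%SET)%N.
    have : (#|b i :&: block k|%SET <= 1)%N.
      apply/card_le1_eqP => x y; rewrite !inE => /andP[xi xk] /andP[yi yk].
      apply/eqP; apply: contraNT ik => xy; apply/eqP.
      by apply: (@lin _ _ x y) => //; rewrite eq_sym.
    by have := cardsID (block k) (b i); rewrite b3; lia.
  case/card_gt1P => x [y []]; rewrite !inE => /andP[xk xi] /andP[yk yi] xy.
  by exists x, y.
have cross k k' p q x y : p \in block k -> q \in block k -> x \in block k' ->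
    y \in block k' -> p != q -> x != y ->
    0 < orient (val p) (val q) (val x) * orient (val p) (val q) (val y) ->
    exists s1 s2, [/\ F k s1, F k' s2 & disjointness_graph s1 s2].
  move=> pk qk xk yk pq xy sd.
  have [s1 E1] := pair _ _ pq; have [s2 E2] := pair _ _ xy.
  exists s1, s2; rewrite /F E1 E2 !finset.subUset !finset.sub1set pk qk xk yk.
  by split=> //; apply: disjoint_of_same_side E1 E2 sd.
have gsym : symmetric (@disjointness_graph R V) by move=> s1 s2; apply: disj_set_sym.
(* By [side], any two points off a side of the polygon lie on the same side of its line. *)
have crossJ j k : inr j != k ->
    exists s1 s2, [/\ F (inr j) s1, F k s2 & disjointness_graph s1 s2].
  move=> jk; case: k jk => [i|j'] jk.
    have [|x [y [xi yi xy xj yj]]] := outside i (inr j); first by rewrite eq_sym.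
    by apply: (cross _ _ (u j) (v j) x y) => //; rewrite ?side // !inE eqxx ?orbT.
  have nj : j' != j by apply: contraNneq jk => ->.
  apply: (cross _ _ (u j) (v j) (u j') (v j')) => //;
    rewrite ?side //= !inE ?eqxx ?orbT // negb_or.
    by rewrite (inj_eq uinj) nj uv.
  by rewrite (inj_eq vinj) nj eq_sym uv.
rewrite -card_sum; apply: (@achromatic_number_ge _ _ _ F) => //.
- case=> [i|j].
    have /card_gt1P[x [y [xi yi xy]]] : (1 < #|b i|)%N by rewrite b3.
    by have [s E] := pair _ _ xy; exists s; rewrite /F E finset.subUset !finset.sub1set xi.
  by have [s E] := pair _ _ (uv j j); exists s; rewrite /F E.
- move=> k k' s Fk Fk'; have /cards2P[x [y [xy E]]] := valP s.
  move: Fk Fk'; rewrite /F E !finset.subUset !finset.sub1set => /andP[xk yk] /andP[xk' yk'].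
  exact: (@lin _ _ x y).
- move=> s; have /cards2P[x [y [xy E]]] := valP s.
  by apply: (@common_endpoint_meet _ _ _ _ x); rewrite E !inE eqxx.
- by move=> k s1 s2; apply: meet.
case=> [i|j] k ik; last exact: crossJ.
case: k ik => [i'|j] ik; last first.
  have [|s1 [s2 [F1 F2 d]]] := crossJ j (inl i); first by rewrite eq_sym.
  by exists s2, s1; rewrite gsym.
have [p [q [pi qi pq pi' qi']]] := outside _ _ ik.
have /card_gt2P[x [y [z [[xi yi zi] [xy yz zx]]]]] : (2 < #|b i'|)%N by rewrite b3.
have off t : t \in b i' -> orient (val p) (val q) (val t) != 0.
  move=> ti; apply: gen; rewrite /= !inE negb_or pq andbT /=.
  by apply/andP; split; [apply: contraNneq pi' => ->|apply: contraNneq qi' => ->].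
(* Two of the three vertices lie on the same side of the line [pq]. *)
case: (two_of_same_sign (off x xi) (off y yi) (off z zi)) => h.
- exact: (cross _ _ p q x y).
- exact: (cross _ _ p q y z).
- exact: (cross _ _ p q z x).
Qed.

(** * Placing the design on the polygon *)

Lemma index_flatten_pairs (T J : eqType) (u v : J -> T) (js : seq J) (r : seq T) j :
  injective u -> injective v -> (forall j j', u j != v j') -> j \in js ->
  let t := flatten [seq [:: u j; v j] | j <- js] ++ r in
  index (v j) t = (index (u j) t).+1.
Proof.
move=> uinj vinj uv; elim: js => //= j0 js IH; rewrite inE.
case: (eqVneq j j0) => [-> _|nj /= /IH ->]; first by rewrite !eqxx (negPf (uv _ _)).
rewrite !(inj_eq uinj) !(inj_eq vinj) ![j0 == j]eq_sym (negPf nj) (negPf (uv _ _)).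
by rewrite [v j0 == _]eq_sym (negPf (uv _ _)).
Qed.

Lemma uniq_flatten_pairs (T J : eqType) (u v : J -> T) (js : seq J) :
  injective u -> injective v -> (forall j j', u j != v j') -> uniq js ->
  uniq (flatten [seq [:: u j; v j] | j <- js]).
Proof.
move=> uinj vinj uv; elim: js => //= j0 js IH /andP[nj /IH ->].
rewrite inE (negPf (uv _ _)) /= andbT; apply/andP; split;
  apply/flattenP => -[_ /mapP[j jjs ->]]; rewrite !inE => /orP[].
- by move/eqP/uinj => E; rewrite E jjs in nj.
- by rewrite (negPf (uv _ _)).
- by rewrite eq_sym (negPf (uv _ _)).
- by move/eqP/vinj => E; rewrite E jjs in nj.
Qed.

(** List the points of the design with each [u j] immediately before [v j], and match this list [t]
    with the sorted vertices [s]. The pairs indexed by [J] then become sides of the polygon. *)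
Lemma achromatic_number_convex_position (R : realType) (m : nat) (V : {fset 'rV[R]_2}) :
  ~~ odd m -> #|` V| = m.+2 -> convex_position V ->
  (7 * m.+2 ^ 2 + m.+2 <= 42 * achromatic_number (@disjointness_graph R V) + 1898)%N.
Proof.
move=> m_even cV cpV.
have [gen _] := convex_position_orient cpV.
have [s [us sV s_pos]] := convex_position_sorted cpV.
have [I [J [b [u [v [b3 [uinj vinj uv] lin le]]]]]] := triangle_matching_design m_even.
apply: leq_trans le _; rewrite leq_add2r leq_mul2l /=.
pose T : finType := option 'I_m.+1.
pose tJ := flatten [seq [:: u j; v j] | j <- enum J].
pose t : seq T := tJ ++ [seq x <- enum T | x \notin tJ].
have ut : uniq t.
  rewrite cat_uniq uniq_flatten_pairs ?enum_uniq // filter_uniq ?enum_uniq // andbT /=.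
  by apply/hasPn => x; rewrite mem_filter => /andP[].
have in_t x : x \in t by rewrite mem_cat mem_filter mem_enum andbT orbN.
have size_s : size s = m.+2.
  by rewrite -cV; apply: perm_size (uniq_perm us (fset_uniq V) sV).
have size_t : size t = size s.
  rewrite size_s -(card_uniqP ut) -[m.+1 in RHS]card_ord -card_option.
  by apply: eq_card => x; rewrite in_t.
have ts x : (index x t < size s)%N by rewrite -size_t index_mem.
have qV x : nth 0 s (index x t) \in V by rewrite -sV mem_nth.
(* The lists have equal length, so the default value 0 of [nth] is never reached. *)
pose q x : V := FSetSub (qV x).
have qinj : injective q.
  move=> x y /(congr1 val) /= /eqP; rewrite nth_uniq // => /eqP E.
  by rewrite -(nth_index x (in_t x)) E nth_index.
have index_v j : index (v j) t = (index (u j) t).+1.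
  by apply: index_flatten_pairs => //; rewrite mem_enum.
apply: (@achromatic_number_blocks _ _ _ _
  (fun i => [set q x | x in b i]%SET) (q \o u) (q \o v)).
- by move=> x y z xyz; apply: gen; rewrite ?fsvalP.
- by move=> i; rewrite card_imset.
- exact: inj_comp.
- exact: inj_comp.
- by move=> j j'; rewrite /= (inj_eq qinj).
- move=> j.
  have left x : x \notin [set q (u j); q (v j)]%SET ->
      0 < orient (val (q (u j))) (val (q (v j))) (val x).
    have xs : val x \in s by rewrite sV fsvalP.
    have xq y : (x == q y) = (val x == nth 0 s (index y t)) by [].
    rewrite !inE negb_or !xq /= index_v.
    have jv : ((index (u j) t).+1 < size s)%N by rewrite -index_v.
    have ju := ltnW jv.
    move: (index (u j) t) jv ju => k jv ju.
    have [l ls ->] : exists2 l, (l < size s)%N & val x = nth 0 s l.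
      by exists (index (val x) s); rewrite ?index_mem ?nth_index.
    rewrite !nth_uniq // => lk.
    (* No index lies strictly between k and k + 1; a vertex before both gives the same orientation
       as one after both, by a cyclic rotation. *)
    have [lt|gt] : (l < k)%N \/ (k.+1 < l)%N by lia.
      by rewrite orient_rot; apply: s_pos; rewrite ?lt /=.
    by apply: s_pos; rewrite ?ltnSn.
  by move=> x y xj yj; rewrite mulr_gt0 ?left.
- pose block k := match k with inl i => b i | inr j => [set u j; v j]%SET end.
  have blockE k : match k with inl i => [set q x | x in b i]%SET
                             | inr j => [set q (u j); q (v j)]%SET end =
      [set q x | x in block k]%SET.
    by case: k => //= j; rewrite imsetU1 imset_set1.
  move=> k k' x y; rewrite /= !blockE => xy /imsetP[x' x'k Ex] /imsetP[y' y'k Ey].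
  rewrite {}Ex {}Ey in xy *; rewrite !(mem_imset _ _ qinj) => x'k' y'k'.
  by apply: (lin k k' x' y' _ x'k y'k x'k' y'k'); rewrite -(inj_eq qinj).
Qed.

(** * The linear term *)

Lemma affine_Theta_id (R : realType) :
  (fun n => (n%:R - 1898) / 42 : R^o) =Theta_\oo (fun n => n%:R : R^o).
Proof.
(* Since 3796 = 2 * 1898, here x - 1898 >= x / 2, whence the factor 1/84. *)
have bounds (x : R) : 3796 <= x ->
    84^-1 * `|x| <= `|(x - 1898) / 42| /\ `|(x - 1898) / 42| <= 1 * `|x|.
  move=> x_large; have x0 : 0 <= x by lra.
  have y0 : 0 <= (x - 1898) / 42 by lra.
  by rewrite (ger0_norm x0) (ger0_norm y0); split; lra.
rewrite eqThetaE qualifE; apply/asboolP; exists (84^-1, 1) => /=.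
  by rewrite invr_gt0 ltr0n ltr01.
near=> n.
have n_large : 3796 <= n%:R :> R by near: n; apply: nbhs_infty_ger.
exact: bounds.
Unshelve. all: by end_near.
Qed.

Theorem theorem7p5 (R : realType) :
  exists h : nat -> R^o,
    [/\ h =Theta_\oo (fun n => n%:R : R^o),
        \forall n \near \oo, 0 < h n :> R
      & forall (n : nat) (V : {fset 'rV[R]_2}),
          ~~ odd n -> #|` V| = n -> convex_position V ->
          n%:R ^+ 2 / 6 + h n
            <= (achromatic_number (@disjointness_graph R V))%:R :> R].
Proof.
(* This is what remains of (7n^2 + n - 1898) / 42 after removing n^2/6. *)
exists (fun n => (n%:R - 1898) / 42); split.
- exact: affine_Theta_id.
- near=> n.
  have n_large : 3796 <= n%:R :> R by near: n; apply: nbhs_infty_ger.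
  by lra.
move=> n V n_even cV cpV.
set a := achromatic_number _.
suff : 7 * n%:R ^+ 2 + n%:R <= 42 * a%:R + 1898 :> R by lra.
rewrite -natrX -!natrM -!natrD ler_nat.
(* For n = 0 the left side is 0, and n = 1 is not even. *)
case: n n_even cV => [|[|m]] // n_even cV.
by rewrite /= negbK in n_even; apply: achromatic_number_convex_position.
Unshelve. all: by end_near.
Qed.
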